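(* Let $q=p^s$ be a prime power with $p$ prime, $m\ge1$, and let $V$ be an $\mathbb{F}_q$-subspace of $\mathbb{F}_q[x_1,\ldots,x_m]$ that has property $( * )$. Let $A$ be the $|V|\times|V|$ matrix with rows and columns indexed by $V$ whose $(f,f')$-entry is $\operatorname{N}_q(f-f')$. Then the eigenvalues of $A$ are $q^{\dim V+m-1}$, $q^{\dim V-1}$ and $0$, with multiplicities $1$, $(q-1)q^m$, and $|V|-(q-1)q^m-1$, respectively. Moreover, the eigenspace corresponding to $q^{\dim V+m-1}$ is spanned by the all-ones vector, and the eigenspace corresponding to $q^{\dim V-1}$ is spanned by the vectors $\big(\zeta_p^{\operatorname{Tr}(Cf(\alpha))}:f\in V\big)$ for $C\in\mathbb{F}_q^*$, $\alpha\in\mathbb{F}_q^m$.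
   Context: $\operatorname{N}_q(g)=|\{\alpha\in\mathbb{F}_q^m:g(\alpha)=0\}|$. $\zeta_p=e^{2\pi i/p}$, $\mathbb{F}_q^*=\mathbb{F}_q\setminus\{0\}$, and $\operatorname{Tr}:\mathbb{F}_q\to\mathbb{F}_p$, $\operatorname{Tr}(a)=a+a^p+\cdots+a^{p^{s-1}}$ is the trace map (its values are viewed as integers mod $p$ in the exponent). A subspace $V$ of $\mathbb{F}_q[x_1,\ldots,x_m]$ has property $( * )$ if $V$ has a basis of monomials $\{x_1^{i_1}\cdots x_m^{i_m}:(i_1,\ldots,i_m)\in\mathcal{I}\}$, where $\mathcal{I}$ is a finite subset of $\mathbb{N}^m$ such that (i) $(0,\ldots,0)\in\mathcal{I}$, and (ii) there exist integers $k_1,\ldots,k_m$ with $(k_1,0,\ldots,0),\ldots,(0,\ldots,0,k_m)\in\mathcal{I}$ and $\gcd(k_i,q-1)=1$ for each $i$.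
   Formalization: In property ( * ) the integers k_i are required to be positive; for q=2 the value k_i=0 would satisfy gcd(k_i,q-1)=1 and the claim would fail, e.g. V={0,1} over F_2, where A is 2^m times the identity. *)

(* Defs.v *)
From HB Require Import structures.
From mathcomp Require Import all_boot all_order all_algebra all_field.
From mathcomp Require Import finmap complex mpoly reals trigo.

Set Implicit Arguments.
Unset Strict Implicit.
Unset Printing Implicit Defensive.

Import Order.TTheory GRing.Theory Num.Theory.
Local Open Scope ring_scope.

Definition is_basis (K : fieldType) (L : lmodType K) (V : {pred L})
    (b : seq L) : Prop :=
  (forall c : 'I_(size b) -> K,
     \sum_(i < size b) c i *: b`_i = 0 -> forall i, c i = 0) /\
  (forall f : L, f \in V <->
     exists c : 'I_(size b) -> K, f = \sum_(i < size b) c i *: b`_i).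

Definition has_dim (K : fieldType) (L : lmodType K) (V : {pred L}) (d : nat)
    : Prop :=
  exists2 b : seq L, is_basis V b & size b = d.

(* The positivity of the k_i only matters for q = 2: there gcd(0, q - 1) = 1,
   so k_i = 0 would satisfy the condition on the axis exponents vacuously
   (e.g. V = {0, 1} over F_2), whereas x |-> x ^ k_i must permute F_q. *)
Definition property_star (F : finFieldType) (m : nat)
    (V : {pred {mpoly F[m]}}) : Prop :=
  exists I : {fset 'X_{1..m}},
    [/\ is_basis V [seq 'X_[mu] | mu <- I],
        0%MM \in I
      & exists k : 'I_m -> nat, forall i : 'I_m,
          [/\ (0 < k i)%N, (U_(i) *+ k i)%MM \in I
            & gcdn (k i) (#|F| - 1) = 1%N]].

Definition Nq (F : finFieldType) (m : nat) (g : {mpoly F[m]}) : nat :=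
  #|[set alpha : {ffun 'I_m -> F} | g.@[alpha] == 0]|.

(* The matrix indexed by V, along an enumeration [e] of V. *)
Definition zeros_mx (F : finFieldType) (m n : nat)
    (e : n.-tuple {mpoly F[m]}) (R : realType) : 'M[R[i]]_n :=
  \matrix_(i < n, j < n) (Nq (tnth e i - tnth e j))%:R.

(* [eigenvalue] and [eigenspace] refer to row vectors; the matrix being
   symmetric, these are also its column eigenvalues and eigenspaces. *)
Lemma zeros_mx_sym (F : finFieldType) (m n : nat)
    (e : n.-tuple {mpoly F[m]}) (R : realType) :
  (zeros_mx e R)^T = zeros_mx e R.
Proof.
apply/matrixP => i j; rewrite !mxE; congr (_%:R).
by apply: eq_card => a; rewrite !inE -(opprB (tnth e i)) mevalN oppr_eq0.
Qed.

Section Trace.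
Variables (F : finFieldType) (p s : nat).

Definition power_trace (a : F) : F := \sum_(i < s) a ^+ (p ^ i).

(* The trace as an element of 'F_p: the class mod p whose image in F is
   a + a^p + ... + a^(p^(s-1)); see [FTrE] for its existence. *)
Definition FTr (a : F) : 'F_p :=
  odflt 0 [pick t : 'F_p | (t : nat)%:R == power_trace a].

Hypotheses (p_pr : prime p) (cardF : #|F| = (p ^ s)%N).

Lemma power_traceX a : power_trace a ^+ p = power_trace a.
Proof.
have pF : p \in [pchar F] by apply: card_finPcharP cardF p_pr.
rewrite -(pFrobenius_autE pF) raddf_sum /=.
under eq_bigr do rewrite pFrobenius_autE -exprM -expnSr.
have s_gt0 : (0 < s)%N.
  by case: s cardF (card_finNzRing_gt1 F) => // ->.
rewrite /power_trace; case: s s_gt0 cardF => // t _ cF.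
rewrite big_ord_recr big_ord_recl /= -cF expf_card expn0 expr1 addrC.
by congr (_ + _); apply: eq_bigr.
Qed.

Lemma FTrE a : (FTr a : nat)%:R = power_trace a.
Proof.
rewrite /FTr; case: pickP => [t /eqP //|noT].
have pF : p \in [pchar F] by apply: card_finPcharP cardF p_pr.
have p_gt1 := prime_gt1 p_pr.
pose r := power_trace a :: [seq (nat_of_ord t)%:R : F | t <- enum 'F_p].
have szP : size ('X^p - 'X : {poly F}) = p.+1.
  by rewrite size_polyDl ?size_polyXn // size_polyN size_polyX.
suff : (size r < size ('X^p - 'X : {poly F})%R)%N.
  by rewrite szP /r /= size_map -cardE card_Fp // ltnn.
apply: max_poly_roots.
- by rewrite -size_poly_eq0 szP.
- apply/allP => x; rewrite inE => /orP[/eqP ->|/mapP[t _ ->]];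
    rewrite rootE !hornerE; first by rewrite power_traceX subrr.
  by rewrite -(pFrobenius_autE pF) rmorph_nat subrr.
rewrite /r cons_uniq; apply/andP; split.
  by apply/mapP => -[t _ /eqP]; rewrite eq_sym noT.
rewrite map_inj_uniq ?enum_uniq // => x y /eqP.
have Fp_lt (z : 'F_p) : (z < p)%N by rewrite -{2}(Fp_cast p_pr).
wlog le_yx : x y / (y <= x)%N => [H|].
  by case/orP: (leq_total y x) => /H // h; rewrite eq_sym => /h.
rewrite -subr_eq0 -natrB // -(dvdn_pcharf pF) => /dvdn_leq.
rewrite subn_gt0; case: ltnP => [_ /(_ isT)|le_xy _].
  by rewrite leqNgt (leq_ltn_trans (leq_subr _ _) (Fp_lt x)).
by apply/val_inj/eqP; rewrite /= eqn_leq le_xy.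
Qed.

End Trace.

Section Spectrum.
Variable R : realType.

(* e ^ (2 i pi / p) *)
Definition zeta (p : nat) : R[i] :=
  Complex (cos (2 * pi / p%:R)) (sin (2 * pi / p%:R)).

Definition char_row (F : finFieldType) (p s m n : nat)
    (e : n.-tuple {mpoly F[m]}) (C : F) (alpha : {ffun 'I_m -> F})
    : 'rV[R[i]]_n :=
  \row_(j < n) zeta p ^+ FTr p s (C * (tnth e j).@[alpha]).

(* Algebraic and geometric multiplicity; they agree for real symmetric
   matrices. *)
Definition eigen_mult (n : nat) (A : 'M[R[i]]_n) (a : R[i]) (k : nat) : Prop :=
  mup a (char_poly A) = k /\ \rank (eigenspace A a) = k.

End Spectrum.

(* Main.v *)
Require Import Defs.
From HB Require Import structures.
From mathcomp Require Import all_boot all_order all_algebra all_field.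
From mathcomp Require Import finmap complex mpoly reals trigo.
From mathcomp Require Import zify lra.

Set Implicit Arguments.
Unset Strict Implicit.
Unset Printing Implicit Defensive.

Import Order.TTheory GRing.Theory Num.Theory.
Local Open Scope ring_scope.

(* Write chi(a) = zeta_p ^ Tr(a), a nontrivial additive character of F. Counting
   zeros by character sums gives
     A = q^-1 sum_(C, alpha) u_(C, alpha) v_(C, alpha),
   where v_(C, alpha) is the row (chi(C f(alpha)))_f and u_(C, alpha) the column
   (chi(- C f(alpha)))_f. The product v_(D, beta) u_(C, alpha) is the sum over V
   of the character f |-> chi(D f(beta) - C f(alpha)): it is |V| if this
   character is trivial and 0 otherwise. Evaluating at f = 1 and at the
   monomials x_i ^ k_i, where x |-> x ^ k_i is injective on F, shows that it is trivial
   only if C = D and (C = 0 or alpha = beta). Hence the v_(C, alpha) are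
   eigenvectors, which bounds the dimensions of the eigenspaces for l1, l2 and 0
   from below by numbers whose sum is n, so that all three bounds are attained
   and A is diagonalizable. *)

(** * Linear algebra: diagonal matrices, multiplicities and dimension counts *)

Section Diagonalizable.
Variables (F : fieldType) (n : nat).
Implicit Types (A P : 'M[F]_n) (d : 'rV[F]_n).

Lemma char_poly_conj A P : P \in unitmx ->
  char_poly (invmx P *m A *m P) = char_poly A.
Proof.
move=> Pu; rewrite /char_poly.
have mapVM : map_mx polyC (invmx P) *m map_mx polyC P = 1%:M.
  by rewrite -map_mxM mulVmx // map_mx1.
have -> : char_poly_mx (invmx P *m A *m P) =
    map_mx polyC (invmx P) *m char_poly_mx A *m map_mx polyC P.
  rewrite /char_poly_mx mulmxBr mulmxBl !map_mxM; congr (_ - _).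
  by rewrite scalar_mxC -mulmxA mapVM mulmx1.
by rewrite !det_mulmx mulrAC -det_mulmx mapVM det1 mul1r.
Qed.

Lemma mup_prod_XsubC (I : finType) (D : I -> F) a :
  mup a (\prod_i ('X - (D i)%:P)) = #|[pred i | D i == a]|.
Proof.
have [] : mup a (\prod_i ('X - (D i)%:P)) = (\sum_i (D i == a))%N /\
   \prod_i ('X - (D i)%:P) != 0.
  elim/big_rec2: _ => [|i k P _ [IH P0]].
    by rewrite mupNroot ?oner_eq0 // rootC oner_eq0.
  rewrite mulf_neq0 ?polyXsubC_eq0 // mupM ?polyXsubC_eq0 // IH; split=> //.
  by rewrite -['X - _]expr1 mup_XsubCX; case: eqP.
by move=> -> _; rewrite -sum1_card [RHS]big_mkcond; apply: eq_bigr => i _ /=;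
  rewrite !inE; case: (D i == a).
Qed.

(** The support of [d] bounds the rank from above. Adding the diagonal matrix [d0] that has 1
    exactly where [d] vanishes gives an invertible matrix, so subadditivity of the rank gives the
    lower bound. *)
Lemma mxrank_diag d : \rank (diag_mx d) = #|[pred i | d 0%R i != 0%R]|.
Proof.
have leq_supp (d' : 'rV[F]_n) :
    (\rank (diag_mx d') <= #|[pred i | d' 0%R i != 0%R]|)%N.
  have -> : diag_mx d' = \sum_(i | d' 0 i != 0) d' 0 i *: delta_mx i i.
    rewrite diag_mx_sum_delta [LHS](bigID [pred i | d' 0 i != 0]) /=.
    rewrite addrC big1 ?add0r // => i.
    by rewrite negbK => /eqP ->; rewrite scale0r.
  rewrite -sum1_card; elim/big_rec2: _ => [|i k B _ IH].
    by rewrite mxrank0.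
  apply: leq_trans (mxrank_add _ _) (leq_add _ IH).
  by rewrite (leq_trans (mxrank_scale _ _)) // mxrank_delta.
pose d0 := \row_i ((d 0 i == 0)%:R : F).
have d0supp : #|[pred i | d0 0%R i != 0%R]| =
    #|[predC [pred i | d 0%R i != 0%R]]|.
  apply: eq_card => i; rewrite !inE mxE; case: (d 0 i == 0).
    by rewrite oner_neq0.
  by rewrite eqxx.
have unit_sum : diag_mx d + diag_mx d0 \in unitmx.
  rewrite -raddfD unitmxE det_diag unitfE; apply/prodf_neq0 => i _.
  by rewrite !mxE; case: (eqVneq (d 0 i) 0) => [->|];
    rewrite ?add0r ?addr0 ?oner_eq0.
apply/eqP; rewrite eqn_leq leq_supp /=.
have := mxrank_add (diag_mx d) (diag_mx d0); rewrite (mxrank_unit unit_sum).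
move: (leq_supp d0); rewrite d0supp => le0 le.
rewrite -(leq_add2r #|[predC [pred i | d 0%R i != 0%R]]|) cardC card_ord.
exact: leq_trans le (leq_add _ le0).
Qed.

(** After conjugation to a diagonal matrix, both sides count the diagonal entries equal to [a]. *)
Lemma mup_char_poly_diagonalizable A a : diagonalizable A ->
  mup a (char_poly A) = \rank (eigenspace A a).
Proof.
case=> P Pu /diagonalizable_forPex[d /(similarLR Pu)].
move=> ->; rewrite conjVmx // char_poly_conj // char_poly_trig; last first.
  exact: diag_mx_is_trig.
under eq_bigr do rewrite mxE eqxx mulr1n.
rewrite mup_prod_XsubC /eigenspace mxrank_ker.
have -> : invmx P *m diag_mx d *m P - a%:M =
    invmx P *m diag_mx (d - const_mx a) *m P.
  rewrite raddfB /= diag_const_mx mulmxBr mulmxBl; congr (_ - _).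
  by rewrite scalar_mxC -mulmxA mulVmx // mulmx1.
(* [mxrankMfree] cancels an invertible factor on the right only; transposing brings the left factor
   there. *)
rewrite mxrankMfree ?row_free_unit // -mxrank_tr trmx_mul mxrankMfree.
  rewrite mxrank_tr mxrank_diag -[X in (X - _)%N](card_ord n).
  rewrite -(cardC [pred i | d 0 i == a]).
  rewrite -[LHS](addnK #|[predC [pred i | d 0%R i == a]]|); congr (_ - _)%N.
  by apply: eq_card => i; rewrite !inE !mxE subr_eq0.
by rewrite row_free_unit unitmx_tr unitmx_inv.
Qed.

Lemma sum_rank_eigenspace A (rs : seq F) : uniq rs ->
  (\sum_(r <- rs) \rank (eigenspace A r))%N =
    \rank (\sum_(r <- rs) eigenspace A r)%MS.
Proof.
move=> rsu; rewrite (big_nth 0) [in RHS](big_nth 0) !big_mkord; apply/esym.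
suff dx : mxdirect (\sum_(i < size rs) eigenspace A rs`_i).
  by rewrite (mxdirectP dx).
apply: mxdirect_sum_eigenspace => i j _ _ rsij; apply/val_inj.
by apply: uniqP rsij; rewrite ?inE.
Qed.

Lemma sum_rank_eigenspace_leq A (rs : seq F) : uniq rs ->
  (\sum_(r <- rs) \rank (eigenspace A r) <= n)%N.
Proof. by move=> /sum_rank_eigenspace->; exact: rank_leq_row. Qed.

Lemma diagonalizable_sum_rank A (rs : seq F) : uniq rs ->
  (\sum_(r <- rs) \rank (eigenspace A r) = n)%N -> diagonalizable A.
Proof.
move=> rsu sumn; apply/diagonalizablePeigen; exists rs => //.
apply/eqmxP; rewrite submx1 /= sub1mx -/(row_full _) /row_full.
by rewrite -sum_rank_eigenspace // sumn.
Qed.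

(** Eigenspaces for distinct values form a direct sum, so their ranks add up to at most [n]. Lower
    bounds with sum at least [n] are therefore all attained, and a fourth eigenvalue has no room
    left. *)
Lemma diagonalizable_three_eigenvalues A a b c ka kb kc :
  uniq [:: a; b; c] ->
  (ka <= \rank (eigenspace A a))%N -> (kb <= \rank (eigenspace A b))%N ->
  (kc <= \rank (eigenspace A c))%N -> (n <= ka + kb + kc)%N ->
  [/\ diagonalizable A, (ka + kb + kc)%N = n,
      [/\ \rank (eigenspace A a) = ka, \rank (eigenspace A b) = kb
        & \rank (eigenspace A c) = kc]
    & forall x, eigenvalue A x -> x \in [:: a; b; c]].
Proof.
move=> abc ra rb rc n_leq.
have := sum_rank_eigenspace_leq A abc; rewrite 3!big_cons big_nil => sum_leq.
have [Ea Eb Ec] : [/\ \rank (eigenspace A a) = ka,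
    \rank (eigenspace A b) = kb & \rank (eigenspace A c) = kc].
  move: (\rank (eigenspace A a)) (\rank (eigenspace A b)) ra rb sum_leq.
  move: (\rank (eigenspace A c)) rc n_leq; clear=> tc hc.
  by move=> h ta tb ha hb hs; split; lia.
have n_eq : (ka + kb + kc)%N = n.
  move: sum_leq; rewrite Ea Eb Ec addn0 addnA => sum_leq.
  by apply/eqP; rewrite eqn_leq sum_leq.
split=> // [|x x_eig].
  apply: (diagonalizable_sum_rank abc).
  by rewrite 3!big_cons big_nil Ea Eb Ec addn0 addnA.
apply: contraLR x_eig => xabc; have := @sum_rank_eigenspace_leq A (x :: _).
move=> /(_ [:: a; b; c]); rewrite cons_uniq xabc abc => /(_ isT).
rewrite 4!big_cons big_nil Ea Eb Ec addn0 (addnA ka) n_eq.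
by rewrite -[X in (_ <= X)%N]add0n leq_add2r leqn0 mxrank_eq0 /eigenvalue negbK.
Qed.

End Diagonalizable.

(** * The complex number [zeta R p] as a nontrivial [p]-th root of unity *)

Section Zeta.
Variables (R : realType) (p : nat).
Hypothesis p_pr : prime p.

Lemma cos_sinX (x : R) k :
  Complex (cos x) (sin x) ^+ k = Complex (cos (x * k%:R)) (sin (x * k%:R)).
Proof.
elim: k => [|k IH]; first by rewrite expr0 mulr0 cos0 sin0.
rewrite exprS IH -[k.+1]add1n natrD mulrDr mulr1 cosD sinD.
by apply/eqP; rewrite eq_complex /= eqxx [X in _ == X]addrC eqxx.
Qed.

Lemma zeta_order : zeta R p ^+ p = 1.
Proof.
rewrite cos_sinX divfK ?pnatr_eq0 -?lt0n ?prime_gt0 //.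
by rewrite mulr_natl cos2pi sin2pi.
Qed.

(** With x = pi / p, the real part is cos(2x) = 2 cos(x)^2 - 1. Were it 1, sin(x) would be 0,
    whereas 0 < x < pi. *)
Lemma zeta_neq1 : zeta R p != 1.
Proof.
apply/eqP => /(congr1 (@complex.Re R)) /= /eqP.
rewrite -mulrA mulr_natl cos_mulr2n; set x := pi / p%:R.
have pR : 0 < p%:R :> R by rewrite ltr0n prime_gt0.
have : 0 < sin x.
  apply: sin_gt0_pi; rewrite divr_gt0 ?pi_gt0 //= ltr_pdivrMr //.
  by rewrite ltr_pMr ?pi_gt0 // ltr1n prime_gt1.
have := cos2Dsin2 x; move: (cos x) (sin x) => c t ct t0.
have t2 : 0 < t ^+ 2 by rewrite exprn_gt0.
by move=> /eqP c1; lra.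
Qed.

Lemma zeta_exp_mod i j : i = j %[mod p] -> zeta R p ^+ i = zeta R p ^+ j.
Proof.
by move=> ij; rewrite -(expr_mod i zeta_order) ij (expr_mod j zeta_order).
Qed.

(** By Bezout, an exponent [k] coprime to [p] would force [zeta R p] itself to be 1. *)
Lemma zeta_exp_eq1 k : zeta R p ^+ k = 1 -> (p %| k)%N.
Proof.
move=> zk; apply: contraTT zeta_neq1; rewrite -prime_coprime // => cop.
have k_gt0 : (0 < k)%N.
  by case: k cop {zk} => //; rewrite /coprime gcdn0 => /eqP p1;
    move: p_pr; rewrite p1.
have [u v uv _] := egcdnP p k_gt0; rewrite negbK.
have : zeta R p ^+ (u * k) = 1 by rewrite mulnC exprM zk expr1n.
rewrite uv gcdnC (eqP cop) exprD mulnC exprM zeta_order expr1n mul1r expr1.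
by move/eqP.
Qed.

End Zeta.

(** * The additive character given by the trace, and character sums *)

(** This turns identities between traces, which hold in the field, into congruences between the
    exponents of [zeta R p]. *)
Lemma eqn_mod_pchar (K : nzRingType) (p i j : nat) : p \in [pchar K] ->
  i%:R = j%:R :> K -> i = j %[mod p].
Proof.
move=> pK; wlog le_ij : i j / (i <= j)%N => [H ij|/esym/eqP].
  by case: (leqP i j) => [/H->//|/ltnW/H-> //].
rewrite -subr_eq0 -natrB // -(dvdn_pcharf pK) => /esym ij.
by apply/esym/eqP; rewrite eqn_mod_dvd.
Qed.

Section AdditiveCharacter.
Variables (R : realType) (p s : nat) (F : finFieldType).
Hypotheses (p_pr : prime p) (cardF : #|F| = (p ^ s)%N).

Let pF : p \in [pchar F]. Proof. exact: card_finPcharP cardF p_pr. Qed.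

Definition tr_char (a : F) : R[i] := zeta R p ^+ FTr p s a.

Lemma power_traceD (a b : F) :
  power_trace p s (a + b) = power_trace p s a + power_trace p s b.
Proof.
rewrite /power_trace -big_split; apply: eq_bigr => i _ /=.
by rewrite exprDn_pchar // (eq_pnat _ (pcharf_eq pF)) pnatX pnat_id.
Qed.

Lemma tr_charD a b : tr_char (a + b) = tr_char a * tr_char b.
Proof.
rewrite /tr_char -exprD; apply: zeta_exp_mod => //; apply: (eqn_mod_pchar pF).
by rewrite natrD !(FTrE p_pr cardF) power_traceD.
Qed.

Lemma tr_char0 : tr_char 0 = 1.
Proof.
rewrite /tr_char -(expr0 (zeta R p)); apply: zeta_exp_mod => //.
apply: (eqn_mod_pchar pF); rewrite (FTrE p_pr cardF).
apply: (addrI (power_trace p s (0 : F))).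
by rewrite -power_traceD !addr0.
Qed.

(** The trace is a polynomial function of degree p^(s-1), so it has fewer than p^s = |F| roots. *)
Lemma power_trace_neq0 : exists a : F, power_trace p s a != 0.
Proof.
case: s cardF (card_finNzRing_gt1 F) => [->//|t cF _].
pose P : {poly F} := \sum_(i < t.+1) 'X^(p ^ i).
have szP : size P = (p ^ t).+1.
  rewrite /P big_ord_recr /= addrC size_polyDl size_polyXn //.
  rewrite ltnS; apply: leq_trans (size_sum _ _ _) _; apply/bigmax_leqP => i _.
  by rewrite size_polyXn ltn_exp2l ?prime_gt1.
apply/existsP; apply: contraT; rewrite negb_exists => /forallP noT.
have : (size (enum F) < size P)%N.
  apply: max_poly_roots; rewrite ?enum_uniq -?size_poly_eq0 ?szP //.
  apply/allP => x _; rewrite rootE horner_sum.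
  have := noT x; rewrite negbK => /eqP tr0; rewrite -[X in _ == X]tr0.
  by apply/eqP/eq_bigr => i _; rewrite hornerXn.
by rewrite szP -cardE cF ltnS leqNgt ltn_exp2l ?prime_gt1 ?ltnSn.
Qed.

Lemma tr_char_neq1 : exists a, tr_char a != 1.
Proof.
have [a ta] := power_trace_neq0; exists a; apply: contra ta => /eqP.
by move/(zeta_exp_eq1 p_pr); rewrite (dvdn_pcharf pF) (FTrE p_pr cardF).
Qed.

End AdditiveCharacter.

(* A sum of a nontrivial character over a translation-invariant family is
   multiplied by a value other than 1 when the family is translated. *)
Lemma sum_character_eq0 (V : zmodType) (K : idomainType) (r : seq V)
    (psi : V -> K) v0 :
  perm_eq [seq v0 + v | v <- r] r ->
  (forall v, psi (v0 + v) = psi v0 * psi v) -> psi v0 != 1 ->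
  \sum_(v <- r) psi v = 0.
Proof.
move=> pr psiD psi1; apply/eqP.
have /eqP := perm_big _ pr : \sum_(v <- _) psi v = \sum_(v <- r) psi v.
rewrite big_map (eq_bigr _ (fun v _ => psiD v)) -mulr_sumr -subr_eq0.
by rewrite -{2}[\sum_(v <- r) _]mul1r -mulrBl mulf_eq0 subr_eq0 (negPf psi1).
Qed.

Lemma translate_perm_eq (V : zmodType) (r : seq V) v0 : uniq r ->
  (forall v, v \in r -> v0 + v \in r) -> perm_eq [seq v0 + v | v <- r] r.
Proof.
move=> ru clo; apply: uniq_perm => //.
  by rewrite map_inj_uniq //; exact: addrI.
apply: (uniq_min_size _ _ _).2; rewrite ?map_inj_uniq ?size_map //.
  exact: addrI.
by move=> _ /mapP[v vr ->]; exact: clo.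
Qed.

Lemma sum_tr_charM (R : realType) (p s : nat) (F : finFieldType) (a : F) :
  prime p -> #|F| = (p ^ s)%N ->
  \sum_(C : F) tr_char R p s (C * a) = (if a == 0 then #|F| else 0%N)%:R.
Proof.
move=> p_pr cardF; case: eqVneq => [->|a0].
  by under eq_bigr do rewrite mulr0 tr_char0 //; rewrite sumr_const.
have [b b1] := tr_char_neq1 R p_pr cardF.
(* Translating C by b / a translates C * a by b, where the character differs from 1. *)
rewrite -big_enum; apply: (sum_character_eq0 (v0 := b / a)).
- by apply: translate_perm_eq; rewrite ?enum_uniq // => v _; rewrite mem_enum.
- by move=> v; rewrite mulrDl tr_charD.
- by rewrite divfK.
Qed.

(** Stacking the rows [v i] and juxtaposing the columns [w j] gives matrices whose product is [c]
    times the identity of size [#|P|]; hence the stacked matrix has full row rank. *)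
Lemma mxrank_biorthogonal (K : fieldType) (I : finType) (P : {pred I}) (n : nat)
    (v : I -> 'rV[K]_n) (w : I -> 'cV[K]_n) (c : K) : c != 0 ->
  (forall i j, i \in P -> j \in P ->
     v i *m w j = (if i == j then c else 0)%:M) ->
  (#|P| <= \rank (\sum_(i in P) <<v i>>)%MS)%N.
Proof.
move=> c0 vw.
pose B := \matrix_(i < #|P|) v (enum_val i).
pose B' := \matrix_(i < n, j < #|P|) w (enum_val j) i 0.
have BB' : B *m B' = c%:M.
  apply/matrixP => i j; rewrite !mxE.
  have /matrixP/(_ 0 0) := vw _ _ (enum_valP i) (enum_valP j).
  rewrite !mxE (inj_eq enum_val_inj) => vwij.
  transitivity (if i == j then c else 0 : K).
    rewrite -[RHS]mulr1n -vwij; apply: eq_bigr => k _.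
    by rewrite !mxE.
  by case: eqP.
have <- : \rank B = #|P|.
  apply/eqP; rewrite eqn_leq rank_leq_row /=.
  have := mxrankM_maxl B B'.
  by rewrite BB' -scalemx1 mxrank_scale_nz // mxrank1.
apply/mxrankS/row_subP => i; rewrite rowK.
by apply: (sumsmx_sup (enum_val i)); rewrite ?genmxE ?enum_valP.
Qed.

(** * Power maps on a finite field, cardinality of a subspace, separation of points *)

Section FiniteField.
Variable F : finFieldType.

(** For nonzero x and y with the same image, x / y is killed by the exponents [k] and |F| - 1, hence
    by their gcd 1. The value 0 is treated apart: [k > 0] makes it the only preimage of 0. *)
Lemma expf_coprime_inj k : (0 < k)%N -> gcdn k (#|F| - 1) = 1%N ->
  injective (fun x : F => x ^+ k).
Proof.
move=> k_gt0 cop x y; have [-> /eqP|y0 xy] := eqVneq y 0.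
  by rewrite expr0n gtn_eqF // expf_eq0 k_gt0 => /eqP.
have x0 : x != 0.
  by move: y0; apply: contraNneq => x0; move/esym/eqP: xy;
    rewrite x0 expr0n gtn_eqF // expf_eq0 k_gt0.
have uX z : z != 0 :> F -> z ^+ (#|F| - 1) = 1.
  move=> z0; apply: (mulfI z0); rewrite -exprS subn1 prednK ?expf_card;
    rewrite ?mulr1 //.
  by rewrite (leq_trans _ (card_finNzRing_gt1 F)).
have [a b ab _] := egcdnP (#|F| - 1) k_gt0.
have : (x / y) ^+ (a * k) = 1.
  by rewrite mulnC exprM expr_div_n xy divff ?expf_neq0 // expr1n.
rewrite ab cop exprD mulnC exprM uX ?mulf_neq0 ?invr_eq0 // expr1n mul1r expr1.
by move=> xy1; rewrite -[x](divfK y0) xy1 mul1r.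
Qed.

Lemma mem_basis (L : lmodType F) (V : {pred L}) (b : seq L) f :
  is_basis V b -> f \in b -> f \in V.
Proof.
move=> [_ memV] fb; apply/memV.
have fi : (index f b < size b)%N by rewrite index_mem.
exists (fun i => (i == Ordinal fi)%:R).
rewrite (bigD1 (Ordinal fi)) //= eqxx scale1r nth_index // big1 ?addr0 // => i.
by move/negPf->; rewrite scale0r.
Qed.

(** Coordinates in a basis put the subspace in bijection with the functions from ['I_d] to [F]. *)
Lemma has_dim_card (L : lmodType F) (V : {pred L}) d (r : seq L) :
  has_dim V d -> uniq r -> r =i V -> size r = (#|F| ^ d)%N.
Proof.
move=> [b [bfree bV] <-] ru rV.
pose comb (c : {ffun 'I_(size b) -> F}) := \sum_i c i *: b`_i.
have comb_inj : injective comb.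
  move=> c c' cc'; apply/ffunP => i; apply/eqP; rewrite -subr_eq0; apply/eqP.
  apply: (bfree (fun i => c i - c' i)).
  under eq_bigr do rewrite scalerBl.
  by rewrite sumrB -/(comb c) -/(comb c') cc' subrr.
rewrite -[in RHS](card_ord (size b)) -card_ffun -sum1_card sum1_size.
rewrite -(size_map comb).
apply/perm_size/uniq_perm; rewrite ?map_inj_uniq ?index_enum_uniq // => f.
rewrite rV; apply/idP/mapP => [/bV[c ->]|[c _ ->]].
  exists [ffun i => c i]; first by rewrite mem_index_enum.
  by apply: eq_bigr => i _; rewrite ffunE.
by apply/bV; exists c.
Qed.

(** Two points that differ in coordinate i are separated by the monomial x_i ^ k_i. The character
    sums use property (star) only in this form. *)
Lemma property_star_separates m (V : {pred {mpoly F[m]}}) :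
  property_star V -> 1 \in V /\
  forall alpha beta : {ffun 'I_m -> F}, alpha != beta ->
    exists2 g, g \in V & g.@[alpha] != g.@[beta].
Proof.
case=> I [basisI I0 [k kP]].
have XV mu : mu \in I -> 'X_[mu] \in V.
  by move=> muI; apply: mem_basis basisI _; exact: map_f.
split=> [|alpha beta ab]; first by rewrite -mpolyX0; exact: XV.
have [i abi] : exists i, alpha i != beta i.
  apply/existsP; apply: contraNT ab; rewrite negb_exists => /forallP ab.
  by apply/eqP/ffunP => i; have := ab i; rewrite negbK => /eqP.
have [k_gt0 kI cop] := kP i; exists 'X_[U_(i) *+ k i]; first exact: XV.
have mX (h : {ffun 'I_m -> F}) : 'X_[U_(i) *+ k i].@[h] = h i ^+ k i.
  by rewrite -mpolyXn rmorphXn /= mevalXU.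
by rewrite !mX (inj_eq (expf_coprime_inj k_gt0 cop)).
Qed.

End FiniteField.

(** * Character rows as eigenvectors of the matrix of zero counts *)

Section ZerosMatrix.
Variables (R : realType) (p s m : nat) (F : finFieldType).
Hypotheses (p_pr : prime p) (cardF : #|F| = (p ^ s)%N).
Variables (V : {pred {mpoly F[m]}}).
Hypotheses (V_submod : submod_closed V) (V_star : property_star V).
Variables (n : nat) (e : n.-tuple {mpoly F[m]}).
Hypotheses (e_uniq : uniq e) (e_V : e =i V).

Local Notation chi := (tr_char R p s).
Local Notation v := (char_row R p s e).
Let u C (alpha : {ffun 'I_m -> F}) : 'cV[R[i]]_n :=
  \col_j chi (- (C * (tnth e j).@[alpha])).

Lemma char_row_mul (D C : F) (beta alpha : {ffun 'I_m -> F}) :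
  v D beta *m u C alpha =
    (if (D == C) && ((C == 0) || (beta == alpha)) then n%:R else 0)%:M.
Proof.
pose L (f : {mpoly F[m]}) := D * f.@[beta] - C * f.@[alpha].
have LZ a f : L (a *: f) = a * L f.
  by rewrite /L !mevalZ mulrCA [C * _]mulrCA -mulrBr.
have -> : v D beta *m u C alpha = (\sum_(f <- e) chi (L f))%:M.
  rewrite [LHS]mx11_scalar mxE [in RHS]big_tuple; congr (_%:M).
  by apply: eq_bigr => j _; rewrite !mxE -[zeta _ _ ^+ _]/(chi _) -tr_charD.
congr (_%:M); case: ifPn => [/andP[/eqP DC Cab]|].
  rewrite (eq_bigr (fun=> 1)) => [|f _].
    by rewrite big_tuple sumr_const card_ord.
  suff -> : L f = 0 by rewrite tr_char0.
  rewrite /L DC; case/orP: Cab => /eqP ->; first by rewrite !mul0r subrr.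
  by rewrite subrr.
move=> DCab; have [V1 Vsep] := property_star_separates V_star.
(* If C = D, then C is nonzero and g separates [alpha] from [beta]; if not, the constant 1 works,
   since L 1 = D - C. *)
have [g gV Lg] : exists2 g, g \in V & L g != 0.
  move: DCab; rewrite negb_and negb_or; case: (eqVneq D C) => [DC|DC _] /=.
    case/andP=> C0 /Vsep[g gV gab]; exists g => //.
    by rewrite /L DC -mulrBr mulf_neq0 // subr_eq0.
  by exists 1; rewrite ?V1 // /L !meval1 !mulr1 subr_eq0.
have [b b1] := tr_char_neq1 R p_pr cardF.
(* [L] is linear, so this multiple of [g] has [L]-value [b], where the character differs from 1. *)
apply: (sum_character_eq0 (v0 := (b / L g) *: g)).
- apply: translate_perm_eq => // f; rewrite !e_V => fV.
  by case: V_submod => _; apply.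
- by move=> f; rewrite -tr_charD // /L !mevalD !mulrDr opprD addrACA.
- by rewrite LZ divfK.
Qed.

(** By orthogonality, the average over C of chi(C g(alpha)) is 1 if g(alpha) = 0 and 0 otherwise;
    summing over alpha counts the zeros of g. *)
Lemma zeros_mxE : zeros_mx e R =
  \sum_C \sum_alpha (#|F|%:R)^-1 *: (u C alpha *m v C alpha).
Proof.
have q0 : #|F|%:R != 0 :> R[i].
  by rewrite pnatr_eq0 -lt0n (leq_trans _ (card_finNzRing_gt1 F)).
(* Transposing makes the entry the zero count of f_j - f_i, matching the minus sign carried by the
   column [u]. *)
rewrite -zeros_mx_sym; apply/matrixP => i j; rewrite summxE 2!mxE /Nq.
set g := tnth e j - tnth e i.
under eq_bigr => C _ do rewrite summxE.
transitivity (\sum_(C : F) \sum_(alpha : {ffun 'I_m -> F})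
    (#|F|%:R)^-1 * chi (C * g.@[alpha])).
  rewrite exchange_big -sum1_card natr_sum big_mkcond /=; apply: eq_bigr => a _.
  rewrite -mulr_sumr sum_tr_charM // inE.
  by case: eqP => _; rewrite ?mulVf ?mulr0.
apply: eq_bigr => C _; apply: eq_bigr => a _.
rewrite !mxE big_ord1 !mxE -[zeta _ _ ^+ _]/(chi _) -tr_charD //.
by rewrite mevalB mulrBr addrC.
Qed.

Lemma char_row_zeros_mx (D : F) (beta : {ffun 'I_m -> F}) :
  v D beta *m zeros_mx e R =
    (n%:R / #|F|%:R * (if D == 0%R then #|F| ^ m else 1)%N%:R) *: v D beta.
Proof.
rewrite zeros_mxE mulmx_sumr (bigD1 D) //= [X in _ + X]big1 ?addr0 => [|C CD].
  rewrite mulmx_sumr.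
  under eq_bigr do rewrite -scalemxAr mulmxA char_row_mul eqxx mul_scalar_mx.
  case: eqVneq => [D0|D0] /=.
    rewrite -[_ *: _ in RHS]scalerA scaler_nat.
    (* For D = 0 the rows [v 0 alpha] all coincide, which produces the factor |F|^m. *)
    transitivity (\sum_(alpha : {ffun 'I_m -> F}) (n%:R / #|F|%:R) *: v D beta).
      apply: eq_bigr => a _; rewrite scalerA mulrC; congr (_ *: _).
      by apply/rowP => j; rewrite !mxE D0 !mul0r.
    rewrite sumr_const card_ffun card_ord.
    by rewrite scalerMnr.
  rewrite (bigD1 beta) //= eqxx big1 ?addr0 => [|a aD].
    by rewrite mulr1 scalerA mulrC.
  by rewrite eq_sym (negPf aD) scale0r scaler0.
rewrite mulmx_sumr big1 // => a _.
by rewrite -scalemxAr mulmxA char_row_mul eq_sym (negPf CD) mul_scalar_mx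
  scale0r scaler0.
Qed.

Lemma char_row0 beta : v 0 beta = const_mx 1.
Proof.
by apply/rowP => j; rewrite !mxE mul0r -[LHS]/(chi 0) tr_char0.
Qed.

Let W : 'M[R[i]]_n :=
  (\sum_(C : F | C != 0) \sum_(alpha : {ffun 'I_m -> F}) <<v C alpha>>)%MS.

Lemma mxrank_char_rows_geq : (0 < n)%N -> ((#|F| - 1) * #|F| ^ m <= \rank W)%N.
Proof.
move=> n_gt0.
pose P := [pred x : F * {ffun 'I_m -> F} | x.1 != 0].
have -> : ((#|F| - 1) * #|F| ^ m)%N = #|P|.
  rewrite -[X in (#|_| ^ X)%N](card_ord m) -card_ffun subn1 -(cardC1 (0 : F)).
  by rewrite -cardX; apply: eq_card => x; rewrite !inE andbT.
rewrite /W pair_big_dep.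
apply: leq_trans (mxrank_biorthogonal (v := fun x => v x.1 x.2)
  (w := fun x => u x.1 x.2) (c := n%:R) _ _) _.
- by rewrite pnatr_eq0 -lt0n.
- move=> [C a] [D b]; rewrite !inE /= => C0 D0; rewrite char_row_mul.
  by rewrite (negPf D0) xpair_eqE.
- by apply/eq_leq; congr (\rank _); apply: eq_bigl => x; rewrite !inE andbT.
Qed.

(** In the expansion of the matrix, the terms with C = 0 have rows in the all-ones line and the
    others have rows in [W]. By rank-nullity this bounds the eigenspace for 0 from below. *)
Lemma mxrank_zeros_mx_leq :
  (\rank (zeros_mx e R) <= 1 + (#|F| - 1) * #|F| ^ m)%N.
Proof.
have : (zeros_mx e R <= (const_mx 1 : 'rV_n) + W)%MS.
  rewrite zeros_mxE; apply: summx_sub => C _; apply: summx_sub => a _.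
  apply/scalemx_sub/(submx_trans (submxMl _ _)).
  case: (eqVneq C 0) => [->|C0]; first by rewrite char_row0 addsmxSl.
  apply: submx_trans (addsmxSr _ _); apply: (sumsmx_sup C) => //.
  by apply: (sumsmx_sup a) => //; rewrite genmxE.
move/mxrankS/leq_trans; apply; apply: leq_trans (mxrank_adds_leqif _ _) _.
rewrite leq_add ?rank_leq_row //.
have -> : ((#|F| - 1) * #|F| ^ m)%N =
    (\sum_(C : F | C != 0%R) \sum_(alpha : {ffun 'I_m -> F}) 1)%N.
  by rewrite sum_nat_const cardC1 sum1_card card_ffun card_ord subn1.
have mxrank_sum (I : finType) (Q : pred I) (B : I -> 'M[R[i]]_n) :
    (\rank (\sum_(i | Q i) B i)%MS <= \sum_(i | Q i) \rank (B i))%N.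
  elim/big_rec2: _ => [|i k M _ IH]; first by rewrite mxrank0.
  exact: leq_trans (mxrank_adds_leqif _ _) (leq_add (leqnn _) IH).
apply: leq_trans (mxrank_sum _ _ _) _; apply: leq_sum => C _.
apply: leq_trans (mxrank_sum _ _ _) _; apply: leq_sum => a _.
by rewrite genmxE rank_leq_row.
Qed.

End ZerosMatrix.

Theorem theorem2p6 (R : realType) (p s q m : nat) (F : finFieldType)
    (p_prime : prime p) (q_def : q = (p ^ s)%N) (card_F : #|F| = q)
    (m_ge1 : (1 <= m)%N)
    (V : {pred {mpoly F[m]}}) (V_submod : submod_closed V)
    (V_star : property_star V)
    (d : nat) (dimV : has_dim V d)
    (n : nat) (e : n.-tuple {mpoly F[m]}) (e_uniq : uniq e) (e_V : e =i V) :
  let A : 'M[R[i]]_n := zeros_mx e R in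
  let l1 : R[i] := (q ^ (d + m - 1))%:R in
  let l2 : R[i] := (q ^ (d - 1))%:R in
  [/\ forall a : R[i], eigenvalue A a <-> [\/ a = l1, a = l2 | a = 0],
      [/\ eigen_mult A l1 1,
          eigen_mult A l2 ((q - 1) * q ^ m)
        & eigen_mult A 0 (n - (q - 1) * q ^ m - 1)],
      (eigenspace A l1 :=: (const_mx 1 : 'rV[R[i]]_n))%MS
    & (eigenspace A l2 :=:
         \sum_(C : F | C != 0) \sum_(alpha : {ffun 'I_m -> F})
            <<char_row R p s e C alpha>>)%MS].
Proof.
move=> A l1 l2; have cF : #|F| = (p ^ s)%N by rewrite card_F.
have q_gt1 : (1 < q)%N by rewrite -card_F card_finNzRing_gt1.
have q_gt0 : (0 < q)%N by exact: ltnW.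
have nE : n = (q ^ d)%N.
  by rewrite -(size_tuple e) (has_dim_card dimV e_uniq e_V) card_F.
have n_gt0 : (0 < n)%N by rewrite nE expn_gt0 q_gt0.
set W := (\sum_(C | _) _)%MS; set k := ((q - 1) * q ^ m)%N.
have W_geq : (k <= \rank W)%N.
  rewrite /k -card_F.
  exact: mxrank_char_rows_geq p_prime cF _ V_submod V_star _ _ e_uniq e_V n_gt0.
have k_gt0 : (0 < k)%N by rewrite muln_gt0 subn_gt0 q_gt1 expn_gt0 q_gt0.
have q_dvd_k : (q %| k)%N.
  by rewrite /k -(prednK m_ge1) expnS mulnCA dvdn_mulr.
have W_leq : (\rank W <= n)%N by exact: rank_leq_row.
have n_gt1 : (1 < n)%N.
  apply: leq_trans (leq_trans W_geq W_leq).
  by rewrite (leq_trans q_gt1) // dvdn_leq.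
(* Positivity of [d] ensures that the exponents [d - 1] and [d + m - 1] are not truncated. *)
have d_gt0 : (0 < d)%N by move: n_gt1; rewrite nE; case: (d).
have n_divq : n%:R / q%:R = l2.
  by rewrite nE -{1}(subnK d_gt0) addn1 expnSr natrM mulfK // pnatr_eq0 -lt0n.
have l1E : l1 = n%:R / q%:R * (q ^ m)%:R.
  by rewrite n_divq -natrM -expnD addnBAC.
have eigA C alpha : char_row R p s e C alpha *m A =
    (if C == 0 then l1 else l2) *: char_row R p s e C alpha.
  rewrite (char_row_zeros_mx R p_prime cF V_submod V_star e_uniq e_V) card_F.
  by case: eqP => _; rewrite ?l1E ?mulr1 ?n_divq.
have E1 : ((const_mx 1 : 'rV_n) <= eigenspace A l1)%MS.
  rewrite -(char_row0 R p_prime cF e [ffun=> 0]); apply/eigenspaceP.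
  by rewrite eigA eqxx.
have E2 : (W <= eigenspace A l2)%MS.
  apply/sumsmx_subP => C C0; apply/sumsmx_subP => alpha _; rewrite genmxE.
  by apply/eigenspaceP; rewrite eigA (negPf C0).
have r1 : \rank (const_mx 1 : 'rV[R[i]]_n) = 1%N.
  apply/eqP; rewrite eqn_leq rank_leq_row /= lt0n mxrank_eq0.
  apply/eqP => /rowP/(_ (Ordinal n_gt0)); rewrite !mxE => /eqP.
  by rewrite oner_eq0.
have r2 := leq_trans W_geq (mxrankS E2).
have r0 : (n - k - 1 <= \rank (eigenspace A 0))%N.
  rewrite /eigenspace raddf0 subr0 mxrank_ker -subnDA addnC leq_sub2l //.
  rewrite /k -card_F; exact: mxrank_zeros_mx_leq p_prime cF _ _.
have l2_neq0 : l2 != 0 by rewrite pnatr_eq0 -lt0n expn_gt0 q_gt0.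
have l1_neq0 : l1 != 0 by rewrite pnatr_eq0 -lt0n expn_gt0 q_gt0.
have l12 : l1 != l2.
  by rewrite eqr_nat eqn_exp2l //; apply/eqP; lia.
have rs_uniq : uniq [:: l1; l2; 0].
  by rewrite /= !inE negb_or l12 l1_neq0 l2_neq0.
have r1' := mxrankS E1; rewrite r1 in r1'.
(* This holds even if the subtraction truncates; the equality [n_eq] obtained from it then yields 1
   + k <= n. *)
have n_leq : (n <= 1 + k + (n - k - 1))%N by clear; lia.
have [diagA n_eq [R1 R2 R0] eig_in] :=
  diagonalizable_three_eigenvalues rs_uniq r1' r2 r0 n_leq.
(* If 1 + k = n, then [q], which divides both [k] and [n], would divide 1. The strict inequality
   makes 0 an actual eigenvalue. *)
have k_ltn : (1 + k < n)%N.
  rewrite ltn_neqAle -{2}n_eq leq_addr andbT.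
  apply: contraTneq q_gt1 => nk; rewrite -leqNgt dvdn_leq //.
  by rewrite -(dvdn_addl 1 q_dvd_k) nk nE -(prednK d_gt0) expnS dvdn_mulr.
have mupE a := mup_char_poly_diagonalizable a diagA.
split.
- move=> a; split=> [/eig_in|].
    by rewrite !inE => /or3P[] /eqP ->; constructor.
  case=> ->; rewrite /eigenvalue -mxrank_eq0 (R1, R2, R0) // -lt0n //.
  by rewrite -subnDA subn_gt0 addnC.
- by split; split; rewrite // mupE.
(* An inclusion between spaces of equal rank is an equality; the same argument settles [l2]. *)
- by apply/eqmx_sym/eqmxP; rewrite -(geq_leqif (mxrank_leqif_eq E1)) R1 r1.
- apply/eqmx_sym/eqmxP; rewrite -(geq_leqif (mxrank_leqif_eq E2)) R2.
  exact: W_geq.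
Qed.
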